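(* Let $\mathfrak{L}$ be a left Leibniz algebra over a field $\mathbb{F}$. Then the category $\mathbf{Mod}^{\mathrm{bi}}(\mathfrak{L})$ of $\mathfrak{L}$-bimodules is a reflective subcategory of the category $\mathbf{Mod}^{\mathrm{bi}}_{\mathrm{weak}}(\mathfrak{L})$ of weak $\mathfrak{L}$-bimodules.
   Context: A left Leibniz algebra is an $\mathbb{F}$-vector space $\mathfrak{L}$ with a bilinear multiplication satisfying $x(yz)=(xy)z+y(xz)$ for all $x,y,z\in\mathfrak{L}$. For a vector space $M$ with bilinear left and right $\mathfrak{L}$-actions consider the conditions, for all $x,y\in\mathfrak{L}$, $m\in M$: (LLM) $(xy)\cdot m=x\cdot(y\cdot m)-y\cdot(x\cdot m)$; (LML) $(x\cdot m)\cdot y=x\cdot(m\cdot y)-m\cdot(xy)$; (MLL) $(m\cdot x)\cdot y=m\cdot(xy)-x\cdot(m\cdot y)$. A weak $\mathfrak{L}$-bimodule satisfies (LLM) and (LML); an $\mathfrak{L}$-bimodule satisfies (LLM), (LML) and (MLL). Morphisms in both categories are $\mathbb{F}$-linear maps commuting with both actions, so $\mathbf{Mod}^{\mathrm{bi}}(\mathfrak{L})$ is a full subcategory of $\mathbf{Mod}^{\mathrm{bi}}_{\mathrm{weak}}(\mathfrak{L})$. A subcategory is called reflective if the inclusion functor admits a left adjoint. *)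

(* Defs.v *)
From HB Require Import structures.
From mathcomp Require Import all_boot all_algebra boolp.
Set Implicit Arguments.
Unset Strict Implicit.
Unset Printing Implicit Defensive.
Import GRing.Theory.
Local Open Scope ring_scope.

Record category := Category {
  obj :> Type;
  hom : obj -> obj -> Type;
  idm : forall X, hom X X;
  comp : forall X Y Z, hom Y Z -> hom X Y -> hom X Z;
  comp_idl : forall X Y (f : hom X Y), comp (idm Y) f = f;
  comp_idr : forall X Y (f : hom X Y), comp f (idm X) = f;
  compA : forall X Y Z W (h : hom Z W) (g : hom Y Z) (f : hom X Y),
    comp h (comp g f) = comp (comp h g) f
}.
Arguments hom {c} X Y.
Arguments idm {c} X.
Arguments comp {c X Y Z} g f.

Record functor (C D : category) := Functor {
  fobj :> C -> D;
  fmap : forall X Y : C, hom X Y -> hom (fobj X) (fobj Y);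
  fmap_id : forall X, fmap (idm X) = idm (fobj X);
  fmap_comp : forall X Y Z (g : hom Y Z) (f : hom X Y),
    fmap (comp g f) = comp (fmap g) (fmap f)
}.
Arguments fmap {C D} _ {X Y} _.

Definition left_adjoint (C D : category) (G : functor C D) (H : functor D C)
    : Prop :=
  exists phi : forall (X : C) (Y : D), hom (G X) Y -> hom X (H Y),
  [/\ forall X Y, bijective (@phi X Y),
      forall (X X' : C) (Y : D) (f : hom X' X) (u : hom (G X) Y),
        phi X' Y (comp u (fmap G f)) = comp (phi X Y u) f
    & forall (X : C) (Y Y' : D) (g : hom Y Y') (u : hom (G X) Y),
        phi X Y' (comp g u) = comp (fmap H g) (phi X Y u)].

Record subcategory (C : category) := Subcategory {
  sub_obj : C -> Prop;
  sub_hom : forall X Y : C, hom X Y -> Prop;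
  sub_idm : forall X, sub_obj X -> sub_hom (idm X);
  sub_comp : forall (X Y Z : C) (g : hom Y Z) (f : hom X Y),
    sub_hom g -> sub_hom f -> sub_hom (comp g f)
}.

Section SubcategoryTheory.
Variables (C : category) (S : subcategory C).

Let sobj := {X : C | sub_obj S X}.
Let shom (X Y : sobj) := {f : hom (sval X) (sval Y) | sub_hom S f}.
Let sid (X : sobj) : shom X X := exist _ (idm (sval X)) (sub_idm (svalP X)).
Let scomp (X Y Z : sobj) (g : shom Y Z) (f : shom X Y) : shom X Z :=
  exist _ (comp (sval g) (sval f)) (sub_comp (svalP g) (svalP f)).

Fact sub_comp_idl (X Y : sobj) (f : shom X Y) : scomp (sid Y) f = f.
Proof. by case: f => f Sf; apply: eq_exist; apply: comp_idl. Qed.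

Fact sub_comp_idr (X Y : sobj) (f : shom X Y) : scomp f (sid X) = f.
Proof. by case: f => f Sf; apply: eq_exist; apply: comp_idr. Qed.

Fact sub_compA (X Y Z W : sobj) (h : shom Z W) (g : shom Y Z) (f : shom X Y) :
  scomp h (scomp g f) = scomp (scomp h g) f.
Proof. by apply: eq_exist; apply: compA. Qed.

Definition subcategory_category : category :=
  Category sub_comp_idl sub_comp_idr sub_compA.

Definition inclusion : functor subcategory_category C :=
  @Functor subcategory_category C (fun X => sval X) (fun X Y f => sval f)
    (fun X => erefl) (fun X Y Z g f => erefl).

Definition reflective : Prop :=
  exists G : functor C subcategory_category, left_adjoint G inclusion.

End SubcategoryTheory.

Coercion subcategory_category : subcategory >-> category.

Definition full_subcategory (C : category) (P : C -> Prop) : subcategory C :=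
  @Subcategory C P (fun _ _ _ => True) (fun _ _ => I) (fun _ _ _ _ _ _ _ => I).

Record leftLeibniz (F : fieldType) := LeftLeibniz {
  leib_sort :> lmodType F;
  lbr : {bilinear leib_sort -> leib_sort -> leib_sort};
  leibnizE : forall x y z, lbr x (lbr y z) = lbr (lbr x y) z + lbr y (lbr x z)
}.
Arguments lbr {F l}.

Section Bimodules.
Variables (F : fieldType) (L : leftLeibniz F).

Record biaction := Biaction {
  biact_sort :> lmodType F;
  lact : {bilinear L -> biact_sort -> biact_sort};
  ract : {bilinear biact_sort -> L -> biact_sort}
}.
Arguments lact {b}.
Arguments ract {b}.

Definition LLM (M : biaction) : Prop := forall (x y : L) (m : M),
  lact (lbr x y) m = lact x (lact y m) - lact y (lact x m).

Definition LML (M : biaction) : Prop := forall (x y : L) (m : M),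
  ract (lact x m) y = lact x (ract m y) - ract m (lbr x y).

Definition MLL (M : biaction) : Prop := forall (x y : L) (m : M),
  ract (ract m x) y = ract m (lbr x y) - lact x (ract m y).

Definition is_weak_bimodule (M : biaction) : Prop := LLM M /\ LML M.

Definition is_bimodule (M : biaction) : Prop := [/\ LLM M, LML M & MLL M].

Record weakBimodule := WeakBimodule {
  weak_sort :> biaction;
  weakP : is_weak_bimodule weak_sort
}.

Record biaction_hom (M N : biaction) := BiactionHom {
  bhom :> {linear M -> N};
  bhom_lact : forall (x : L) (m : M), bhom (lact x m) = lact x (bhom m);
  bhom_ract : forall (x : L) (m : M), bhom (ract m x) = ract (bhom m) x
}.

Lemma biaction_hom_eq (M N : biaction) (f g : biaction_hom M N) :
  f =1 g -> f = g.
Proof.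
case: f g => [f fl fr] [g gl gr] /= fg.
have {}fg : f = g.
  case: f g fg {fl fr gl gr} => [f cf] [g cg] /= /funext fg; subst g.
  congr GRing.Linear.Pack; case: cf cg => [[f1] [f2]] [[g1] [g2]].
  by rewrite (Prop_irrelevance f1 g1) (Prop_irrelevance f2 g2).
by subst g; congr BiactionHom; apply: Prop_irrelevance.
Qed.

Definition biaction_id (M : biaction) : biaction_hom M M :=
  @BiactionHom M M idfun (fun _ _ => erefl) (fun _ _ => erefl).

Section Comp.
Variables (M N P : biaction) (g : biaction_hom N P) (f : biaction_hom M N).

Fact biaction_comp_lact (x : L) (m : M) :
  (g \o f) (lact x m) = lact x ((g \o f) m).
Proof. by rewrite /= !bhom_lact. Qed.

Fact biaction_comp_ract (x : L) (m : M) :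
  (g \o f) (ract m x) = ract ((g \o f) m) x.
Proof. by rewrite /= !bhom_ract. Qed.

Definition biaction_comp : biaction_hom M P :=
  @BiactionHom M P (g \o f) biaction_comp_lact biaction_comp_ract.
End Comp.

Fact biaction_comp_idl (M N : biaction) (f : biaction_hom M N) :
  biaction_comp (biaction_id N) f = f.
Proof. exact: biaction_hom_eq. Qed.

Fact biaction_comp_idr (M N : biaction) (f : biaction_hom M N) :
  biaction_comp f (biaction_id M) = f.
Proof. exact: biaction_hom_eq. Qed.

Fact biaction_compA (M N P Q : biaction) (h : biaction_hom P Q)
    (g : biaction_hom N P) (f : biaction_hom M N) :
  biaction_comp h (biaction_comp g f) = biaction_comp (biaction_comp h g) f.
Proof. exact: biaction_hom_eq. Qed.

Definition Mod_bi_weak : category :=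
  @Category weakBimodule (fun M N => biaction_hom M N)
    (fun M => biaction_id M) (fun _ _ _ g f => biaction_comp g f)
    (fun _ _ f => biaction_comp_idl f) (fun _ _ f => biaction_comp_idr f)
    (fun _ _ _ _ h g f => biaction_compA h g f).

Definition Mod_bi : subcategory Mod_bi_weak :=
  @full_subcategory Mod_bi_weak (fun M : weakBimodule => is_bimodule M).

End Bimodules.

Arguments lact {F L b}.
Arguments ract {F L b}.

(* Main.v *)
From HB Require Import structures.
From mathcomp Require Import all_boot all_algebra boolp.
Require Import Defs.
Set Implicit Arguments.
Unset Strict Implicit.
Unset Printing Implicit Defensive.
Import GRing.Theory Quotient.
Local Open Scope ring_scope.
Local Open Scope quotient_scope.

(** The reflection of a weak bimodule M is M / K, where K is the smallest
    subspace stable under both actions that contains the defects of (MLL),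
    (m.x).y - (m.(xy) - x.(m.y)). The quotient inherits (LLM) and (LML), and
    satisfies (MLL) since the defects vanish in it. The kernel of a morphism
    from M to a bimodule is stable and contains the defects, hence contains K,
    so the morphism factors uniquely through M / K. *)

(** * Quotient of a biaction by a stable subspace *)

Section Quotient.
Variables (F : fieldType) (L : leftLeibniz F) (M : biaction L).

(** [{quot S}] is formed from an additive subgroup only; the other closure fields serve to carry
    scalars and both actions down to it. *)
Record subBiaction := SubBiaction {
  sub_zmod :> zmodClosed M;
  subZ : forall a m, m \in sub_zmod -> a *: m \in sub_zmod;
  sub_lact : forall x m, m \in sub_zmod -> lact x m \in sub_zmod;
  sub_ract : forall x m, m \in sub_zmod -> ract m x \in sub_zmod
}.

Variable S : subBiaction.

Definition bquot : Type := {quot S}.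
HB.instance Definition _ := GRing.Zmodule.on bquot.

Definition bpi (m : M) : bquot := \pi_{quot S} m.
Definition brepr (q : bquot) : M := repr (q : {quot S}).

Lemma breprK : cancel brepr bpi.
Proof. exact: reprK. Qed.

Lemma bpiP u v : reflect (bpi u = bpi v) (u - v \in S).
Proof. by rewrite idealrBE; apply: eqP. Qed.

Lemma mem_breprB m : brepr (bpi m) - m \in S.
Proof. by apply/bpiP; rewrite breprK. Qed.

Lemma bpiD : {morph bpi : u v / u + v}.
Proof. exact: raddfD. Qed.

Definition bscale a q := bpi (a *: brepr q).

(** Independence of the representative: [brepr (bpi m)] and [m] differ by an element of [S], which
    is stable under scalars. The module axioms then come from [M] by writing each class as
    [bpi (brepr q)]. *)
Lemma bpiZ a m : bpi (a *: m) = bscale a (bpi m).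
Proof. by apply/esym/bpiP; rewrite -scalerBr subZ ?mem_breprB. Qed.

Fact bscaleA a b q : bscale a (bscale b q) = bscale (a * b) q.
Proof. by rewrite -[q]breprK -!bpiZ scalerA. Qed.

Fact bscale1 : left_id 1 bscale.
Proof. by move=> q; rewrite -[q]breprK -bpiZ scale1r. Qed.

Fact bscaleDr : right_distributive bscale +%R.
Proof.
by move=> a p q; rewrite -[p]breprK -[q]breprK -bpiD -!bpiZ -bpiD scalerDr.
Qed.

Fact bscaleDl q : {morph bscale^~ q : a b / a + b}.
Proof. by move=> a b; rewrite -[q]breprK -!bpiZ -bpiD scalerDl. Qed.

HB.instance Definition _ := GRing.Zmodule_isLmodule.Build F bquot
  bscaleA bscale1 bscaleDr bscaleDl.

Fact bpi_linear : linear bpi.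
Proof. by move=> a u v; rewrite bpiD bpiZ. Qed.
HB.instance Definition _ := GRing.isLinear.Build F M bquot *:%R bpi bpi_linear.

Definition blact x q := bpi (lact x (brepr q)).
Definition bract q x := bpi (ract (brepr q) x).

Lemma bpi_lact x m : bpi (lact x m) = blact x (bpi m).
Proof. by apply/esym/bpiP; rewrite -linearBr sub_lact ?mem_breprB. Qed.

Lemma bpi_ract x m : bpi (ract m x) = bract (bpi m) x.
Proof. by apply/esym/bpiP; rewrite -linearBl sub_ract ?mem_breprB. Qed.

Fact blact_bilinear : bilinear_for *:%R *:%R blact.
Proof.
split=> [q a x y|x a p q]; first by rewrite /blact linearPl linearP.
(* [brepr] need not be linear, so linearity in the class is read off in [M] after [bpi_lact]. *)
rewrite -[p]breprK -[q]breprK -linearP -!bpi_lact -linearP.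
by rewrite linearPr.
Qed.
HB.instance Definition _ :=
  bilinear_isBilinear.Build F L bquot bquot *:%R *:%R blact blact_bilinear.

Fact bract_bilinear : bilinear_for *:%R *:%R bract.
Proof.
split=> [x a p q|q a x y]; last by rewrite /bract linearPr linearP.
rewrite -[p]breprK -[q]breprK -linearP -!bpi_ract -linearP.
by rewrite linearPl.
Qed.
HB.instance Definition _ :=
  bilinear_isBilinear.Build F bquot L bquot *:%R *:%R bract bract_bilinear.

Definition quot_biaction : biaction L := @Biaction F L bquot blact bract.

Definition quot_pi : biaction_hom M quot_biaction :=
  @BiactionHom F L M quot_biaction bpi bpi_lact bpi_ract.

Lemma quot_piK q : quot_pi (brepr q) = q.
Proof. exact: breprK. Qed.

(** Surjectivity of [quot_pi] makes it an epimorphism; this is the uniqueness half of the universal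
    property. *)
Lemma quot_hom_eq (N : biaction L) (f g : biaction_hom quot_biaction N) :
  biaction_comp f quot_pi = biaction_comp g quot_pi -> f = g.
Proof.
move=> fg; apply: biaction_hom_eq => q; rewrite -[q]quot_piK.
exact: (congr1 (fun h : biaction_hom M N => h (brepr q)) fg).
Qed.

Lemma quot_weak_bimodule : is_weak_bimodule M -> is_weak_bimodule quot_biaction.
Proof.
move=> [llm lml]; split=> x y q; rewrite -[q]quot_piK.
  by rewrite -!bhom_lact llm linearB.
by rewrite -!(bhom_lact, bhom_ract) lml linearB.
Qed.

Lemma quot_MLL :
    (forall x y m,
      ract (ract m x) y - (ract m (lbr x y) - lact x (ract m y)) \in S) ->
  MLL quot_biaction.
Proof.
move=> mll x y q; rewrite -[q]quot_piK -!(bhom_lact, bhom_ract) -linearB.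
exact/bpiP/mll.
Qed.

(** * Factorisation of morphisms through the quotient *)

Section Factor.
Variables (N : biaction L) (f : biaction_hom M N).
Hypothesis f0 : forall m, m \in S -> f m = 0.

Definition factor (q : bquot) : N := f (brepr q).

Lemma factor_pi m : factor (bpi m) = f m.
Proof. by apply/eqP; rewrite -subr_eq0 -linearB f0 ?mem_breprB. Qed.

Fact factor_linear : linear factor.
Proof.
move=> a p q; rewrite -[p]breprK -[q]breprK -linearP !factor_pi.
exact: linearP.
Qed.
HB.instance Definition _ :=
  GRing.isLinear.Build F quot_biaction N *:%R factor factor_linear.

Fact factor_lact x (q : quot_biaction) : factor (lact x q) = lact x (factor q).
(* By definition [lact x q] is the class of [lact x (brepr q)], so [factor_pi] applies at once. *)
Proof. by rewrite factor_pi bhom_lact. Qed.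

Fact factor_ract x (q : quot_biaction) : factor (ract q x) = ract (factor q) x.
Proof. by rewrite factor_pi bhom_ract. Qed.

Definition factor_hom : biaction_hom quot_biaction N :=
  @BiactionHom F L quot_biaction N factor factor_lact factor_ract.

Lemma factor_homK : biaction_comp factor_hom quot_pi = f.
Proof. by apply: biaction_hom_eq => m; apply: factor_pi. Qed.

End Factor.
End Quotient.

Section Reflection.
Variables (F : fieldType) (L : leftLeibniz F).

(** * The stable subspace generated by the defects of (MLL) *)

Section Kernel.
Variable M : biaction L.

Definition mll_defect x y (m : M) : M :=
  ract (ract m x) y - (ract m (lbr x y) - lact x (ract m y)).

Record contains_mll_defects (P : M -> Prop) : Prop := {
  cmd0 : P 0;
  cmdP : forall a u v, P u -> P v -> P (a *: u + v);
  cmd_lact : forall x m, P m -> P (lact x m);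
  cmd_ract : forall x m, P m -> P (ract m x);
  cmd_defect : forall x y m, P (mll_defect x y m)
}.

(** Generation is expressed as an intersection over all admissible predicates, which makes
    minimality immediate; [asbool] turns it into the boolean predicate needed for a quotient. *)
Definition mll_kernel (m : M) : bool :=
  `[< forall P, contains_mll_defects P -> P m >].

Lemma mll_kernelP m :
  reflect (forall P, contains_mll_defects P -> P m) (m \in mll_kernel).
Proof. exact: asboolP. Qed.

Fact mll_kernel_linear : linear_closed mll_kernel.
Proof.
move=> a u v /mll_kernelP Ku /mll_kernelP Kv; apply/mll_kernelP => P cP.
by apply: (cmdP cP); [apply: Ku | apply: Kv].
Qed.

Fact mll_kernel0 : 0 \in mll_kernel.
Proof. by apply/mll_kernelP => P; apply: cmd0. Qed.

Fact mll_kernel_zmod : zmod_closed mll_kernel.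
Proof.
split=> [|u v Ku Kv]; first exact: mll_kernel0.
(* The difference is put in the form [-1 *: v + u]. *)
by rewrite addrC -scaleN1r mll_kernel_linear.
Qed.
HB.instance Definition _ := GRing.isZmodClosed.Build M mll_kernel
  mll_kernel_zmod.

Fact mll_kernelZ a m : m \in mll_kernel -> a *: m \in mll_kernel.
Proof. by move=> Km; rewrite -[_ *: _]addr0 mll_kernel_linear ?mll_kernel0. Qed.

Fact mll_kernel_lact x m : m \in mll_kernel -> lact x m \in mll_kernel.
Proof.
move=> /mll_kernelP Km; apply/mll_kernelP => P cP.
by apply: (cmd_lact cP); apply: Km.
Qed.

Fact mll_kernel_ract x m : m \in mll_kernel -> ract m x \in mll_kernel.
Proof.
move=> /mll_kernelP Km; apply/mll_kernelP => P cP.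
by apply: (cmd_ract cP); apply: Km.
Qed.

Definition mll_sub : subBiaction M :=
  @SubBiaction F L M (GRing.ZmodClosed.clone M mll_kernel _)
    mll_kernelZ mll_kernel_lact mll_kernel_ract.

Lemma mem_mll_defect x y m : mll_defect x y m \in mll_sub.
Proof. by apply/mll_kernelP => P cP; apply: (cmd_defect cP). Qed.

(** The zero set of [f] is one of the predicates intersected in [mll_kernel]: [f] commutes with both
    actions, so it sends defects in [M] to defects in [N], which vanish by (MLL). *)
Lemma mll_sub_ker (N : biaction L) (f : biaction_hom M N) :
  MLL N -> forall m, m \in mll_sub -> f m = 0.
Proof.
move=> mll m /mll_kernelP /(_ (fun u => f u = 0)); apply; split.
- exact: linear0.
- by move=> a u v fu fv; rewrite linearP fu fv scaler0 addr0.
- by move=> x u fu; rewrite bhom_lact fu linear0r.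
- by move=> x u fu; rewrite bhom_ract fu linear0l.
by move=> x y u; rewrite 2!linearB !(bhom_ract, bhom_lact) mll subrr.
Qed.

End Kernel.

(** * The reflector and the adjunction *)

Definition reflection_weak (M : weakBimodule L) : Mod_bi_weak L :=
  WeakBimodule (quot_weak_bimodule (mll_sub M) (weakP M)).

Fact reflection_bimodule M : is_bimodule (reflection_weak M).
Proof.
by have [] := weakP (reflection_weak M); split=> //;
  apply/quot_MLL/mem_mll_defect.
Qed.

Definition reflection (M : Mod_bi_weak L) : Mod_bi L :=
  exist _ (reflection_weak M) (reflection_bimodule M).

Definition unit_hom (M : Mod_bi_weak L) : hom M (inclusion _ (reflection M)) :=
  quot_pi (mll_sub (M : weakBimodule L)).

Lemma sval_MLL (N : Mod_bi L) : MLL (sval N : weakBimodule L).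
Proof. by have [] := svalP N. Qed.

Definition extend (M : Mod_bi_weak L) (N : Mod_bi L)
    (f : hom M (inclusion _ N)) : hom (reflection M) N :=
  exist _ (factor_hom (@mll_sub_ker _ _ f (@sval_MLL N))) I.

Definition restrict (M : Mod_bi_weak L) (N : Mod_bi L)
    (u : hom (reflection M) N) : hom M (inclusion _ N) :=
  comp (fmap (inclusion _) u) (unit_hom M).

Lemma extendK M N : cancel (@extend M N) (@restrict M N).
Proof. by move=> f; apply: factor_homK. Qed.

Lemma restrict_inj M N : injective (@restrict M N).
(* The subcategory is full, so morphisms carry only a proof of [True] and are compared on their
   underlying maps, where the projection cancels. *)
Proof. by move=> [u []] [v []] /quot_hom_eq uv; apply: eq_exist. Qed.

Lemma restrictK M N : cancel (@restrict M N) (@extend M N).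
Proof. by move=> u; apply: restrict_inj; rewrite extendK. Qed.

Lemma restrict_comp M (N N' : Mod_bi L) (g : hom N N')
    (u : hom (reflection M) N) :
  restrict (comp g u) = comp (fmap (inclusion _) g) (restrict u).
Proof. by rewrite /restrict fmap_comp compA. Qed.

(** The only choice that makes the unit natural. *)
Definition reflection_map (M M' : Mod_bi_weak L) (f : hom M M') :
  hom (reflection M) (reflection M') := extend (comp (unit_hom M') f).

Lemma restrict_map M M' (N : Mod_bi L) (f : hom M' M)
    (u : hom (reflection M) N) :
  restrict (comp u (reflection_map f)) = comp (restrict u) f.
Proof. by rewrite restrict_comp extendK compA. Qed.

Fact reflection_map_id M : reflection_map (idm M) = idm (reflection M).
Proof.
(* Morphisms out of a reflection are determined by their restrictions along the unit, so
   functoriality is checked after restricting. *)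
by apply: restrict_inj; rewrite extendK /restrict fmap_id comp_idl comp_idr.
Qed.

Fact reflection_map_comp (M1 M2 M3 : Mod_bi_weak L) (g : hom M2 M3)
    (f : hom M1 M2) :
  reflection_map (comp g f) = comp (reflection_map g) (reflection_map f).
Proof. by apply: restrict_inj; rewrite restrict_map !extendK compA. Qed.

Definition reflector : functor (Mod_bi_weak L) (Mod_bi L) :=
  Functor reflection_map_id reflection_map_comp.

End Reflection.

Theorem proposition3p17 (F : fieldType) (L : leftLeibniz F) :
  reflective (Mod_bi L).
Proof.
(* The hom-set bijection is precomposition with the unit, and its inverse is factorisation through
   the quotient. *)
exists (reflector L), (@restrict F L); split.
- by move=> M N; exists (@extend F L M N); [apply: restrictK | apply: extendK].
- by move=> M M' N f u; apply: restrict_map.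
- by move=> M N N' g u; apply: restrict_comp.
Qed.
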